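(* Let $d,r\ge1$, let $M_\ell$, $1\le\ell\le r$, be $d\times d$ invertible integer matrices, and let $a_\ell:\mathbb{Z}^d\to\mathbb{R}$, $\ell=1,\dots,r$, be finitely supported masks. Then the following conditions are equivalent. (i) For all $v\in l(\mathbb{Z}^d)$, $$\sum_{\ell=1}^r \mathrm{S}_{a_\ell,M_\ell}\,\mathrm{T}_{a_\ell,M_\ell}\,v=v .$$ (ii) For every $\omega\in\Omega:=\bigcup_{\ell=1}^r\Omega_{M_\ell}$, where $\Omega_{M_\ell}:=[(M_\ell^T)^{-1}\mathbb{Z}^d]\cap[0,1)^d$, and every $\xi\in\mathbb{R}^d$, $$\sum_{\ell\in\{1\le n\le r\,:\,\omega\in\Omega_{M_n}\}}\widehat{a_\ell}(\xi)\,\overline{\widehat{a_\ell}(\xi+2\pi\omega)}=\delta(\omega).$$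
   Context: $l(\mathbb{Z}^d)$ is the space of all complex-valued sequences on $\mathbb{Z}^d$. For an invertible integer $d\times d$ matrix $M$ and a finitely supported sequence (mask) $a:\mathbb{Z}^d\to\mathbb{R}$, the subdivision operator $\mathrm{S}_{a,M}$ and the transition operator $\mathrm{T}_{a,M}$ on $l(\mathbb{Z}^d)$ are $$[\mathrm{S}_{a,M}v](n)=|\det M|\sum_{k\in\mathbb{Z}^d}v(k)\,a(n-Mk),\qquad [\mathrm{T}_{a,M}v](n)=\sum_{k\in\mathbb{Z}^d}v(k)\,\overline{a(k-Mn)} .$$ Further, $\hat a(\xi)=\sum_{k\in\mathbb{Z}^d}a(k)e^{-ik\cdot\xi}$, and $\delta(0)=1$, $\delta(\omega)=0$ for $\omega\ne0$. *)

(* Defs.v *)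
From HB Require Import structures.
From mathcomp Require Import all_boot all_order all_algebra.
From mathcomp Require Import all_classical all_reals all_analysis.
From mathcomp Require Export complex.
Set Implicit Arguments.
Unset Strict Implicit.
Unset Printing Implicit Defensive.
Import Order.TTheory GRing.Theory Num.Theory.
Local Open Scope classical_set_scope.
Local Open Scope ring_scope.

(* Z^d is ['cV[int]_d], R^d is ['cV[R]_d], C is [R[i]].  The sums
   [\sum_(k \in setT)] over Z^d are the finitely supported sums of fsbigop: the
   library operator is 0 on a family with infinite support, a case that does
   not arise below when the mask is finitely supported and M is invertible. *)

Definition int_to_real_mx (R : realType) (d n : nat) (A : 'M[int]_(d, n)) :
    'M[R]_(d, n) :=
  map_mx intr A.
Arguments int_to_real_mx R {d n} A.

Definition finitely_supported (R : realType) (d : nat)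
    (a : 'cV[int]_d -> R) : Prop :=
  finite_set [set k | a k != 0].

Definition subdivision (R : realType) (d : nat) (a : 'cV[int]_d -> R)
    (M : 'M[int]_d) (v : 'cV[int]_d -> R[i]) : 'cV[int]_d -> R[i] :=
  fun n => (`|\det M|)%:~R *
    \sum_(k \in [set: 'cV[int]_d]) v k * real_complex R (a (n - M *m k)).

Definition transition (R : realType) (d : nat) (a : 'cV[int]_d -> R)
    (M : 'M[int]_d) (v : 'cV[int]_d -> R[i]) : 'cV[int]_d -> R[i] :=
  fun n =>
    \sum_(k \in [set: 'cV[int]_d]) v k * (real_complex R (a (k - M *m n)))^*.

Definition dot (R : realType) (d : nat) (k : 'cV[int]_d) (xi : 'cV[R]_d) : R :=
  \sum_(i < d) (k i 0)%:~R * xi i 0.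

(* e^{i t} for real t *)
Definition expi (R : realType) (t : R) : R[i] := Complex (cos t) (sin t).

Definition symbol (R : realType) (d : nat) (a : 'cV[int]_d -> R)
    (xi : 'cV[R]_d) : R[i] :=
  \sum_(k \in [set: 'cV[int]_d]) real_complex R (a k) * expi (- dot k xi).

Definition Omega (R : realType) (d : nat) (M : 'M[int]_d) : set 'cV[R]_d :=
  [set invmx (int_to_real_mx R M^T) *m int_to_real_mx R k | k in [set: 'cV[int]_d]] `&`
  [set w | forall i, 0 <= w i 0 < 1].
Arguments Omega R {d} M.

Definition delta (R : realType) (d : nat) (w : 'cV[R]_d) : R[i] :=
  if w == 0 then 1 else 0.

(* Main.v *)
(* Write e_w(m) = exp(2 pi i w.m), which is [torus_char w m] below.  By the Smith
   normal form, Omega_M is the dual of the finite group Z^d / M Z^d, so the sum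
   of e_w(m) over w in Omega_M is |det M| if m lies in M Z^d and 0 otherwise.
   Inserting this in the kernel of S T gives, with w ranging over the union of
   the Omega_{M_l},
     sum_l S_l T_l v (n) = sum_w e_w(-n) sum_p C_w(p) v(n + p),
     C_w(p) = sum_(l : w in Omega_{M_l}) sum_(t - u = p) e_w(u) a_l(u) a_l(t),
   while the left-hand side of (ii) is sum_p e_w(p) C_w(p) exp(i p.xi).  Linear
   independence of the characters n |-> e_w(-n), respectively
   xi |-> exp(i p.xi), shows that (i) and (ii) are both equivalent to
   C_w(p) = delta(w) delta(p). *)
Require Import Defs.
From HB Require Import structures.
From mathcomp Require Import all_boot all_order all_algebra.
From mathcomp Require Import all_classical all_reals all_analysis.
From mathcomp Require Import ring lra.
Import Order.TTheory GRing.Theory Num.Theory.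
Local Open Scope classical_set_scope.
Local Open Scope ring_scope.
Set Implicit Arguments.
Unset Strict Implicit.

(** * Independence of characters *)

(** Dedekind's argument: the relation at [y + x] minus [chi j y] times the relation at [x] loses its
    [j]-term, and induction applies to the coefficients [c i * (chi i y - chi j y)]. It serves below
    for characters of Z^d and of R^d. *)
Lemma character_independence (F : fieldType) (G : zmodType) (I : eqType)
    (s : seq I) (chi : I -> G -> F) (c : I -> F) :
  uniq s ->
  (forall i, chi i 0 = 1) ->
  (forall i x y, chi i (x + y) = chi i x * chi i y) ->
  {in s &, forall i j, i != j -> exists x, chi i x != chi j x} ->
  (forall x, \sum_(i <- s) c i * chi i x = 0) ->
  {in s, forall i, c i = 0}.
Proof.
move=> + chi0 chiD; elim: s c => [|j s IHs] c //= /andP[jNs s_uniq] sep sum0.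
have c_s : {in s, forall i, c i = 0}.
  move=> i i_s.
  have ij : i != j by apply: contraNneq jNs => <-.
  have [| |y chiij] := sep i j _ _ ij; rewrite ?inE ?eqxx ?i_s ?orbT //.
  suff /(_ i i_s)/eqP : {in s, forall i, c i * (chi i y - chi j y) = 0}.
    by rewrite mulf_eq0 subr_eq0 (negPf chiij) orbF => /eqP.
  apply: (IHs (fun i => c i * (chi i y - chi j y))) => // [k l ks ls|x].
    by apply: sep; rewrite inE ?ks ?ls orbT.
  have := sum0 (y + x); rewrite -[RHS](mulr0 (chi j y)) -[in RHS](sum0 x).
  rewrite !big_cons mulrDr chiD mulrCA => /addrI /eqP.
  rewrite mulr_sumr -subr_eq0 -sumrB => /eqP sum0'.
  rewrite -[RHS]sum0'; apply: eq_bigr => k _.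
  by rewrite chiD mulrBr mulrBl !mulrA; congr (_ - _ * _); rewrite mulrC.
move=> i; rewrite inE => /predU1P[-> |]; last exact: c_s.
have := sum0 0; rewrite big_cons big_seq big1 => [|k ks].
  by rewrite addr0 chi0 mulr1.
by rewrite c_s ?mul0r.
Qed.

(** * Complex exponentials and roots of unity *)

Section Expi.
Variable R : realType.
Implicit Types (t : R) (x : R).

Lemma expi0 : expi (0 : R) = 1.
Proof. by rewrite /expi cos0 sin0. Qed.

Lemma expiD t t' : expi (t + t') = expi t * expi t'.
Proof.
by rewrite /expi cosD sinD; congr Complex; rewrite addrC mulrC [X in _ + X]mulrC.
Qed.

Lemma expi_sum (I : Type) (s : seq I) (P : pred I) (f : I -> R) :
  expi (\sum_(i <- s | P i) f i) = \prod_(i <- s | P i) expi (f i).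
Proof. exact: (big_morph _ expiD expi0). Qed.

Lemma expiN t : expi (- t) = (expi t)^*.
Proof. by rewrite /expi cosN sinN. Qed.

Lemma expiMn t n : expi (t *+ n) = expi t ^+ n.
Proof. by elim: n => [|n IHn]; rewrite ?mulr0n ?expi0// mulrS exprS expiD IHn. Qed.

Lemma expi_neq0 t : expi t != 0.
Proof.
apply/eqP => e0; have /eqP := expiD t (- t).
by rewrite subrr expi0 e0 mul0r oner_eq0.
Qed.

Lemma expi_2pi_int (m : int) : expi (2 * pi * m%:~R) = 1 :> R[i].
Proof.
have e1 : expi (2 * pi) = 1 :> R[i].
  by rewrite mulrDl !mul1r -mulr2n /expi cos2pi sin2pi.
case: m => n; first by rewrite -[X in _ * X]/(n%:R) mulr_natr expiMn e1 expr1n.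
rewrite NegzE mulrNz mulrN mulr_natr expiN expiMn e1 expr1n.
by apply: rmorph1.
Qed.

(** A non-integral [x] has fractional part [y] strictly between 0 and 1; then cos(2 pi y) = 1 would
    force sin(pi y) = 0, yet sine is positive between 0 and pi. *)
Lemma expi_2piE x : (expi (2 * pi * x) == 1) = (x \is a Num.int).
Proof.
apply/eqP/intrP => [|[m ->]]; last exact: expi_2pi_int.
exists (Num.floor x); apply/eqP; rewrite eq_sym eq_le ge_floor /= leNgt.
apply/negP => lt_fx; pose y := x - (Num.floor x)%:~R.
have y0 : 0 < y by rewrite subr_gt0.
have y1 : y < 1 by rewrite ltrBlDl -intrD1 floorD1_gt.
have [] : expi (2 * pi * y) = 1.
  by rewrite mulrBr -mulrN -mulrNz expiD expi_2pi_int mulr1.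
rewrite -mulrA mulr_natl cos_mulr2n => cos1 _.
have : 0 < sin (pi * y).
  by rewrite sin_gt0_pi // mulr_gt0 ?pi_gt0 //= gtr_pMr ?pi_gt0.
have /eqP : sin (pi * y) ^+ 2 = 0 by have := cos2Dsin2 (pi * y); lra.
by rewrite sqrf_eq0 => /eqP ->; rewrite ltxx.
Qed.

(** A geometric sum in z = e^(2 pi i b/n), which is 1 exactly when n divides b; otherwise z - 1
    times the sum is z^n - 1 = 0. *)
Lemma sum_expi_ord (n : nat) (b : int) : (0 < n)%N ->
  \sum_(j < n) expi (2 * pi * (b%:~R * (j%:R / n%:R))) =
  (if (n%:Z %| b)%Z then n%:R else 0) :> R[i].
Proof.
move=> n_gt0; have n_neq0 : n%:R != 0 :> R by rewrite pnatr_eq0 -lt0n.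
pose z : R[i] := expi (2 * pi * (b%:~R / n%:R)).
rewrite (eq_bigr (fun j : 'I_n => z ^+ j)); last first.
  by move=> j _; rewrite -expiMn -[_ *+ j]mulr_natr; congr expi; ring.
have zn : z ^+ n = 1.
  rewrite -expiMn -[_ *+ n]mulr_natr -(expi_2pi_int b); congr expi.
  by rewrite -mulrA divfK.
have z1 : (z == 1) = (n%:Z %| b)%Z.
  rewrite expi_2piE; apply/intrP/dvdzP => -[q].
    move=> /(congr1 ( *%R^~ n%:R)) => bq.
    exists q; apply: (@intr_inj R); rewrite intrM.
    by move: bq; rewrite divfK.
  by move=> ->; exists q; rewrite intrM mulfK.
rewrite -z1; case: ifPn => [/eqP ->|z_neq1].
  under eq_bigr do rewrite expr1n.
  by rewrite sumr_const card_ord.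
have /eqP := subrX1 z n; rewrite zn subrr eq_sym mulf_eq0 subr_eq0.
by rewrite (negPf z_neq1) => /eqP.
Qed.

End Expi.

(** * The pairing of Z^d with R^d *)

Section Dot.
Variables (R : realType) (d : nat).
Implicit Types (k m : 'cV[int]_d) (x y : 'cV[R]_d).

Lemma dotDl k m x : dot (k + m) x = dot k x + dot m x.
Proof. by rewrite -big_split /=; apply: eq_bigr => i _; rewrite mxE intrD mulrDl. Qed.

Lemma dotDr k x y : dot k (x + y) = dot k x + dot k y.
Proof. by rewrite -big_split /=; apply: eq_bigr => i _; rewrite mxE mulrDr. Qed.

Lemma dot0l x : dot 0 x = 0.
Proof. by rewrite /dot big1 // => i _; rewrite mxE mul0r. Qed.

Lemma dot0r k : dot k (0 : 'cV[R]_d) = 0.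
Proof. by rewrite /dot big1 // => i _; rewrite mxE mulr0. Qed.

Lemma dotNl k x : dot (- k) x = - dot k x.
Proof. by apply/eqP; rewrite -subr_eq0 opprK -dotDl addNr dot0l. Qed.

Lemma dotZr k c x : dot k (c *: x) = c * dot k x.
Proof. by rewrite mulr_sumr; apply: eq_bigr => i _; rewrite mxE mulrCA. Qed.

Lemma dot_int k m : dot k (int_to_real_mx R m) = (\sum_i k i 0 * m i 0)%:~R.
Proof. by rewrite rmorph_sum; apply: eq_bigr => i _; rewrite mxE rmorphM. Qed.

Lemma dot_delta_l i x : dot (delta_mx i 0) x = x i 0.
Proof.
rewrite /dot (bigD1 i) //= big1 => [|j ji]; rewrite !mxE ?eqxx ?mul1r ?addr0 //.
by rewrite (negPf ji) mul0r.
Qed.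

Lemma dot_delta_r k i : dot k (delta_mx i 0 : 'cV[R]_d) = (k i 0)%:~R.
Proof.
rewrite /dot (bigD1 i) //= big1 => [|j ji]; rewrite !mxE ?eqxx ?mulr1 ?addr0 //.
by rewrite (negPf ji) mulr0.
Qed.

Lemma dot_mulmx (A : 'M[int]_d) k x :
  dot k (int_to_real_mx R A *m x) = dot (A^T *m k) x.
Proof.
rewrite /dot; under eq_bigr do rewrite mxE mulr_sumr.
rewrite exchange_big /=; apply: eq_bigr => j _.
rewrite mxE rmorph_sum mulr_suml; apply: eq_bigr => i _.
by rewrite !mxE rmorphM mulrA [X in X * _]mulrC.
Qed.

End Dot.

(** * Smith normal form of an invertible integer matrix *)

(** The signs of the diagonal are moved into [U], so that the [n i] are positive and can serve as
    moduli. *)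
Lemma Smith_diag (d : nat) (M : 'M[int]_d) : \det M != 0 ->
  exists (L U : 'M[int]_d) (n : 'I_d -> nat),
    [/\ L \in unitmx, U \in unitmx, forall i, (0 < n i)%N &
        M = L *m diag_mx (\row_i (n i)%:Z) *m U].
Proof.
have [L L_unit [U U_unit [s _ ->]]] := int_Smith_normal_form M.
set D := (\matrix_(i, j) _) => detM.
have DE : D = diag_mx (\row_i (absz s`_i)%:Z) *m diag_mx (\row_i Num.sg s`_i).
  rewrite mulmx_diag; apply/matrixP => i j; rewrite !mxE.
  by rewrite abszE mulrC -numEsg.
(* An index past the end of [s] would read the default 0, which the nonzero determinant excludes as
   well. *)
have s_neq0 (i : 'I_d) : s`_i != 0.
  apply: contraNneq detM => si; rewrite !det_mulmx DE det_mulmx !det_diag.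
  by rewrite [X in _ * (X * _)](bigD1 i) //= mxE si absz0 !(mul0r, mulr0).
exists L, (diag_mx (\row_i Num.sg s`_i) *m U), (fun i => absz s`_i).
split => // [|i|]; last by rewrite DE !mulmxA.
- rewrite unitmx_mul U_unit andbT unitmxE det_diag.
  apply: rpred_prod => i _; rewrite mxE -[X in X \is a _]mulr1.
  by case: sgrP (s_neq0 i) => //= _ _; rewrite mulr1 ?unitrN1.
- by rewrite lt0n absz_eq0.
Qed.

Lemma normr_det_Smith (d : nat) (L U : 'M[int]_d) (n : 'I_d -> nat) :
  L \in unitmx -> U \in unitmx ->
  `|\det (L *m diag_mx (\row_i (n i)%:Z) *m U)| = (\prod_i n i)%:Z.
Proof.
have unit1 (x : int) : x \is a GRing.unit -> `|x| = 1.
  by case/orP => /eqP ->; rewrite ?normrN1 ?normr1.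
rewrite !unitmxE => Lu Uu; rewrite !det_mulmx det_diag !normrM.
rewrite (unit1 _ Lu) (unit1 _ Uu) mulr1 mul1r normr_prod -[RHS]natz natr_prod.
by apply: eq_bigr => i _; rewrite mxE natz.
Qed.

(** * The dual lattice and its character sums *)

Section DualLattice.
Variables (R : realType) (d : nat).
Implicit Types (m k : 'cV[int]_d) (w x : 'cV[R]_d) (M : 'M[int]_d).

Definition torus_char w m : R[i] := expi (2 * pi * dot m w).

Lemma torus_char0 w : torus_char w 0 = 1.
Proof. by rewrite /torus_char dot0l mulr0 expi0. Qed.

Lemma torus_charD w m k : torus_char w (m + k) = torus_char w m * torus_char w k.
Proof. by rewrite /torus_char dotDl mulrDr expiD. Qed.

Lemma torus_charDint w k m :
  torus_char (w + int_to_real_mx R k) m = torus_char w m.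
Proof. by rewrite /torus_char dotDr mulrDr expiD dot_int expi_2pi_int mulr1. Qed.

Lemma eq_modint_unit_cube w w' k :
  (forall i, 0 <= w i 0 < 1) -> (forall i, 0 <= w' i 0 < 1) ->
  w = w' + int_to_real_mx R k -> w = w'.
Proof.
move=> wI w'I ww'; have {ww'} wk i : w i 0 = w' i 0 + (k i 0)%:~R.
  by rewrite ww' !mxE.
apply/colP => i; have := wk i.
have /andP[w0 w1] := wI i; have /andP[w'0 w'1] := w'I i.
have [k0|k0|->] := ltgtP (k i 0) 0; last by rewrite addr0.
- have : (k i 0 + 1)%:~R <= 0%:~R :> R by rewrite ler_int lezD1.
  by rewrite intrD1; lra.
- have : 1 <= (k i 0)%:~R :> R by rewrite ler1z -gtz0_ge1.
  by lra.
Qed.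

(** Tested on unit vectors, a character determines each coordinate of [w] modulo 1, hence [w] itself
    within the unit cube. *)
Lemma torus_char_sep w w' :
  (forall i, 0 <= w i 0 < 1) -> (forall i, 0 <= w' i 0 < 1) -> w != w' ->
  exists m, torus_char w m != torus_char w' m.
Proof.
move=> wI w'I /eqP ww'; apply: contrapT => /forallNP chi_eq; apply: ww'.
have /all_sig[f fE] i : {z : int | w i 0 = w' i 0 + z%:~R}.
  apply: cid; have /intrP[z wz] : w i 0 - w' i 0 \is a Num.int.
    have := chi_eq (delta_mx i 0); move/negP/negPn/eqP.
    rewrite /torus_char !dot_delta_l => eq_chi.
    by rewrite -expi_2piE mulrBr expiD eq_chi -expiD subrr expi0.
  by exists z; rewrite -wz addrC subrK.
apply: (@eq_modint_unit_cube _ _ (\col_i f i)) => //.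
by apply/colP => i; rewrite !mxE fE.
Qed.

Lemma OmegaP M w : int_to_real_mx R M \in unitmx ->
  (w \in Omega R M) <->
  (exists k, int_to_real_mx R M^T *m w = int_to_real_mx R k) /\
  (forall i, 0 <= w i 0 < 1).
Proof.
move=> Mu; have MTu : int_to_real_mx R M^T \in unitmx.
  by rewrite /int_to_real_mx -map_trmx unitmx_tr.
rewrite in_setE; split=> -[].
  by move=> [k _ <-] wI; split => //; exists k; rewrite mulKVmx.
by move=> [k wk] wI; split => //; exists k => //; rewrite -wk mulKmx.
Qed.

Definition fract_mx x : 'cV[R]_d := \col_i (x i 0 - (Num.floor (x i 0))%:~R).

Lemma fract_mxE x :
  exists k, fract_mx x = x + int_to_real_mx R k.
Proof.
exists (- \col_i Num.floor (x i 0)).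
by apply/colP => i; rewrite !mxE rmorphN.
Qed.

Lemma fract_mx_bounds x i : 0 <= fract_mx x i 0 < 1.
Proof. by rewrite mxE subr_ge0 ge_floor ltrBlDl -intrD1 floorD1_gt. Qed.

End DualLattice.

(** Pairing m with L^-T D^-1 f is pairing L^-1 m with D^-1 f, so the character sum is a product of
    one-dimensional sums over roots of unity. It vanishes unless each D_ii divides entry i of L^-1
    m, that is, unless m lies in L D Z^d = M Z^d. *)
Lemma Omega_enum (R : realType) (d : nat) (M : 'M[int]_d) :
  int_to_real_mx R M \in unitmx ->
  exists W : seq 'cV[R]_d,
    [/\ uniq W, forall w, (w \in W) = (w \in Omega R M) &
        forall m, \sum_(w <- W) torus_char w m =
          (`|\det M|)%:~R * (`[< exists k, m = M *m k >])%:R].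
Proof.
move=> Mu; have detM : \det M != 0.
  by move: Mu; rewrite unitmxE det_map_mx unitfE intr_eq0.
have [L [U [n [Lu Uu n_gt0 MLU]]]] := Smith_diag detM.
(* With M = L D U, the points of Omega_M are the representatives in the unit
   cube of L^-T D^-1 f, where f runs over the vectors with 0 <= f_i < D_ii. *)
have n_neq0 i : (n i)%:R != 0 :> R by rewrite pnatr_eq0 -lt0n.
(* The range of [f i] depends on [i]; a common bound [N] allows a plain finite function type, cut
   back by [Q]. *)
pose N := (\max_i n i)%N.
have ltN i (j : nat) : (j < n i)%N -> (j < N.+1)%N.
  by move=> /ltnW/leq_trans; apply; exact: leq_bigmax.
pose Q (i : 'I_d) : pred 'I_N.+1 := fun j => (j < n i)%N.
pose q (f : {ffun 'I_d -> 'I_N.+1}) : 'cV[R]_d := \col_i ((f i)%:R / (n i)%:R).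
pose pt f := int_to_real_mx R (invmx L)^T *m q f.
have LTK (x : 'cV[R]_d) :
    int_to_real_mx R L^T *m (int_to_real_mx R (invmx L)^T *m x) = x.
  by rewrite mulmxA -map_mxM -trmx_mul mulVmx // trmx1 map_mx1 mul1mx.
have LTVK (x : 'cV[R]_d) :
    int_to_real_mx R (invmx L)^T *m (int_to_real_mx R L^T *m x) = x.
  by rewrite mulmxA -map_mxM -trmx_mul mulmxV // trmx1 map_mx1 mul1mx.
pose D := diag_mx (\row_i (n i)%:Z).
have DE (x : 'cV[R]_d) i : (int_to_real_mx R D *m x) i 0 = (n i)%:R * x i 0.
  by rewrite /int_to_real_mx map_diag_mx mul_diag_mx !mxE.
have MTE (x : 'cV[R]_d) : int_to_real_mx R M^T *m x =
    int_to_real_mx R U^T *m (int_to_real_mx R D *m (int_to_real_mx R L^T *m x)).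
  by rewrite !mulmxA -!map_mxM MLU !trmx_mul tr_diag_mx mulmxA.
exists [seq fract_mx (pt f) | f <- enum (family Q)]; split => [|w|m].
- rewrite map_inj_in_uniq ?enum_uniq // => f g.
  rewrite !mem_enum => /familyP fQ /familyP gQ.
  have [[k ->] [l ->]] := (fract_mxE (pt f), fract_mxE (pt g)).
  (* After applying L^T, D^-1 f and D^-1 g agree up to an integer vector, so [f i] and [g i] are
     congruent modulo [n i], and both are below [n i]. *)
  move=> /(congr1 (mulmx (int_to_real_mx R L^T))).
  rewrite !mulmxDr !LTK -!map_mxM.
  move: (L^T *m k) (L^T *m l) => a b qfg.
  apply/ffunP => i; apply/val_inj => /=.
  have /eqP : (f i)%:Z = (g i)%:Z %[mod n i]%Z.
    have := congr1 (fun x : 'cV_d => x i 0) qfg; rewrite !mxE.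
    move=> /(congr1 ( *%R^~ (n i)%:R)); rewrite !mulrDl !divfK // => qfgi.
    have -> : (f i)%:Z = (g i)%:Z + (b i 0 - a i 0) * n i.
      apply: (@intr_inj R); rewrite rmorphD rmorphM rmorphB /= mulrBl.
      by rewrite -!pmulrn addrA -qfgi addrK.
    by rewrite addrC modzMDl.
  by rewrite !modz_nat (modn_small (fQ i)) (modn_small (gQ i)) => /eqP[].
- apply/idP/idP => [/mapP[f _ ->]|/(OmegaP _ Mu)[[k wk] wI]].
    apply/(OmegaP _ Mu); split; last exact: fract_mx_bounds.
    have [k ->] := fract_mxE (pt f).
    (* Since M^T = U^T D L^T, the point L^-T D^-1 f is sent to U^T f. *)
    exists (U^T *m (\col_i (f i)%:Z) + M^T *m k).
    rewrite mulmxDr MTE LTK /int_to_real_mx map_mxD !map_mxM; congr (_ *m _ + _).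
    by apply/colP => i; rewrite DE !mxE mulrC divfK.
  (* This is D L^T w. Dividing entry i by [n i], the remainder gives [f i] and the quotient an
     integer translation. *)
  pose b := (invmx U)^T *m k.
  pose c i : int := b i 0.
  pose f : {ffun 'I_d -> 'I_N.+1} := [ffun i => inord `|(c i %% n i)%Z|].
  (* The remainder is below [n i], hence at most [N], so [inord] does not fall back to its
     default. *)
  have fE i : (f i)%:Z = (c i %% n i)%Z.
    have bi_ge0 : 0 <= (c i %% n i)%Z by rewrite modz_ge0 // -lt0n.
    rewrite ffunE inordK ?gez0_abs // (ltN i) // -ltz_nat gez0_abs //.
    by rewrite ltz_pmod // ltz_nat.
  have fQ : f \in family Q.
    by apply/familyP => i; rewrite unfold_in /= -ltz_nat fE ltz_pmod ?ltz_nat.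
  apply/mapP; exists f; first by rewrite mem_enum.
  have [z ptz] := fract_mxE (pt f).
  have Lw : int_to_real_mx R L^T *m w =
      q f + int_to_real_mx R (\col_i (c i %/ n i)%Z).
    have : int_to_real_mx R D *m (int_to_real_mx R L^T *m w) = int_to_real_mx R b.
      rewrite /b /int_to_real_mx map_mxM -/(int_to_real_mx R k) -wk MTE.
      by rewrite [RHS]mulmxA -map_mxM -trmx_mul mulmxV // trmx1 map_mx1 mul1mx.
    move=> DLw; apply/colP => i; apply: (mulfI (n_neq0 i)).
    rewrite -DE DLw mxE -/(c i) !mxE mulrDr [X in _ = X + _]mulrC divfK //.
    by rewrite {1}(divz_eq (c i) (n i)) rmorphD rmorphM /= -fE -!pmulrn addrC mulrC.
  have weq : w = fract_mx (pt f) +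
      int_to_real_mx R ((invmx L)^T *m (\col_i (c i %/ n i)%Z) - z).
    rewrite ptz -[w in LHS]LTVK Lw mulmxDr -map_mxM /int_to_real_mx map_mxB -addrA.
    by congr (_ + _); rewrite addrC subrK.
  exact: eq_modint_unit_cube wI (fract_mx_bounds _) weq.
- rewrite big_map big_enum /=.
  pose F i (j : nat) : R[i] :=
    expi (2 * pi * (((invmx L *m m) i 0)%:~R * (j%:R / (n i)%:R))).
  (* Both index sets coincide; [pfamily] is the shape required to turn a sum of products into a
     product of sums. *)
  transitivity (\sum_(f in pfamily (ord0 : 'I_N.+1) xpredT Q) \prod_i F i (f i)).
    apply: eq_big => [f|f _].
      apply/familyP/pfamilyP => [fQ|[_ fQ] i]; last exact: fQ.
      split; first exact: subset_predT.
      by move=> i _; apply: fQ.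
    have [k ->] := fract_mxE (pt f).
    rewrite torus_charDint /torus_char dot_mulmx trmxK /dot mulr_sumr expi_sum.
    by apply: eq_bigr => i _; rewrite [q f _ _]mxE.
  rewrite -(big_distr_big_dep _ _ _ (fun i (j : 'I_N.+1) => F i j)).
  under eq_bigr => i _.
    rewrite -(big_ord_widen N.+1 (F i)); last by rewrite ltnW // ltnS leq_bigmax.
    rewrite sum_expi_ord //.
    over.
  rewrite /= [in RHS]MLU normr_det_Smith // -pmulrn natr_prod.
  case: asboolP => [[k mk]|mNk].
    rewrite mulr1; apply: eq_bigr => i _; rewrite mk -!mulmxA mulKmx //.
    by rewrite mul_diag_mx mxE [X in X * _]mxE dvdz_mulr.
  (* If no factor vanished, then L^-1 m = D h for an integer vector h, and m = M (U^-1 h). *)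
  rewrite mulr0; apply/eqP; apply/prodf_eq0; apply: contrapT => dvdm; apply: mNk.
  have /all_sig[h hE] i : {h : int | (invmx L *m m) i 0 = h * n i}.
    apply: cid; apply/dvdzP/negPn/negP => ndvd; apply: dvdm.
    by exists i; rewrite ?(negPf ndvd).
  exists (invmx U *m \col_i h i); rewrite -!mulmxA mulKVmx //.
  rewrite -[m in LHS](mulKVmx Lu); congr (_ *m _); apply/colP => i.
  by rewrite mul_diag_mx hE !mxE mulrC.
Qed.

(** * Finite sums and the kernel of S T *)

(** The list need only contain the support, so one list can serve all masks. *)
Lemma fsbigT_seq (V : nmodType) (T : choiceType) (s : seq T) (f : T -> V) :
  uniq s -> (forall x, x \notin s -> f x = 0) ->
  \sum_(x \in [set: T]) f x = \sum_(x <- s) f x.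
Proof.
move=> s_uniq f0; rewrite (@fsbigE _ _ _ _ _ s) // => [|x _ /f0//].
by apply: eq_bigl => x; rewrite in_setT.
Qed.

Lemma sum_pairs_by_difference (V : nmodType) (G : zmodType) (A P : seq G)
    (F : G -> G -> V) :
  uniq P -> {in A &, forall u t, t - u \in P} ->
  \sum_(u <- A) \sum_(t <- A) F u t =
  \sum_(p <- P) \sum_(u <- A) \sum_(t <- A | t - u == p) F u t.
Proof.
move=> P_uniq AP; rewrite [RHS]exchange_big /=.
apply: eq_big_seq => u uA; under [RHS]eq_bigr do rewrite big_mkcond.
rewrite [RHS]exchange_big; apply: eq_big_seq => t tA.
rewrite -big_mkcond (eq_bigl (pred1 (t - u))); last by move=> p; rewrite /= eq_sym.
by rewrite -big_filter filter_pred1_uniq ?AP // big_seq1.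
Qed.

Lemma conj_real_complex (R : realType) (x : R) :
  (real_complex R x)^* = real_complex R x.
Proof. exact: conjc_real. Qed.

Section Operators.
Variables (R : realType) (d : nat).
Variables (a : 'cV[int]_d -> R) (M : 'M[int]_d) (A : seq 'cV[int]_d).
Hypotheses (Mu : int_to_real_mx R M \in unitmx) (A_uniq : uniq A).
Hypothesis (a_supp : forall k, k \notin A -> a k = 0).

Lemma symbolE xi :
  symbol a xi = \sum_(k <- A) real_complex R (a k) * expi (- dot k xi).
Proof. by apply: fsbigT_seq => // k /a_supp ->; rewrite raddf0 mul0r. Qed.

Lemma transitionE v n :
  transition a M v n = \sum_(t <- A) v (t + M *m n) * real_complex R (a t).
Proof.
rewrite /transition (@fsbigT_seq _ _ [seq t + M *m n | t <- A]) => [||k kNA].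
- by rewrite big_map; apply: eq_bigr => t _; rewrite addrK conj_real_complex.
- by rewrite map_inj_uniq //; apply: addIr.
rewrite conj_real_complex a_supp ?raddf0 ?mulr0 //; apply: contra kNA => kA.
by apply/mapP; exists (k - M *m n); rewrite ?subrK.
Qed.

Lemma mulmx_int_inj : injective (mulmx M : 'cV[int]_d -> 'cV[int]_d).
Proof.
move=> k k' /(congr1 (int_to_real_mx R)); rewrite /int_to_real_mx !map_mxM.
move=> /(can_inj (mulKmx Mu)) kk'; apply/matrixP => i j.
by have /matrixP/(_ i j) := kk'; rewrite !mxE => /intr_inj.
Qed.

(** Put u = n - M k: the sum over k becomes a sum over the u congruent to n modulo M Z^d. This
    constraint, weighted by |det M|, is the character sum over [W] at u - n. *)
Lemma subdivision_transitionE (W : seq 'cV[R]_d) v n :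
  (forall m, \sum_(w <- W) torus_char w m =
     (`|\det M|)%:~R * (`[< exists k, m = M *m k >])%:R) ->
  subdivision a M (transition a M v) n =
  \sum_(w <- W) \sum_(u <- A) \sum_(t <- A)
    torus_char w (u - n) * (real_complex R (a u) * real_complex R (a t)) *
    v (n + (t - u)).
Proof.
move=> W_sum; pose P u := `[< exists k, u - n = M *m k >].
(* [h u] solves u = n - M k where possible; its value elsewhere is filtered out. *)
have /choice[h hE] u : exists k, P u -> u = n - M *m k.
  have [/asboolP[k uk]|_] := boolP (P u); last by exists 0.
  by exists (- k) => _; rewrite mulmxN opprK -uk addrC subrK.
rewrite /subdivision (@fsbigT_seq _ _ [seq h u | u <- A & P u]) => [||k kNA].
- rewrite big_map big_filter big_mkcond mulr_sumr exchange_big /=.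
  apply: eq_bigr => u _; rewrite exchange_big /=.
  under [RHS]eq_bigr => t _ do rewrite -!mulr_suml W_sum.
  rewrite -/(P u); case: ifPn => Pu; last first.
    by rewrite mulr0 big1 // => t _; rewrite !mul0r.
  have Mh : M *m h u = n - u by rewrite [in RHS](hE u Pu) opprB addrC subrK.
  rewrite transitionE Mh subKr mulr1 mulr_suml mulr_sumr; apply: eq_bigr => t _.
  by rewrite addrCA; ring.
- rewrite map_inj_in_uniq ?filter_uniq // => u u'.
  rewrite !mem_filter => /andP[/hE uE _] /andP[/hE u'E _] huu'.
  by rewrite uE huu' -u'E.
rewrite a_supp ?raddf0 ?mulr0 //; apply: contra kNA => kA.
have Pk : P (n - M *m k) by apply/asboolP; exists (- k); rewrite mulmxN addrC addKr.
apply/mapP; exists (n - M *m k); first by rewrite mem_filter Pk.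
by apply: mulmx_int_inj; apply: oppr_inj; apply: (addrI n); rewrite -hE.
Qed.

End Operators.

(** * Products of symbols *)

(** Splitting e_w(t) as e_w(t - u) e_w(u) isolates the factors depending on t - u alone; what
    remains is the summand of C_w. *)
Lemma symbol_mul_conj (R : realType) (d : nat) (a : 'cV[int]_d -> R)
    (A : seq 'cV[int]_d) (w xi : 'cV[R]_d) :
  uniq A -> (forall k, k \notin A -> a k = 0) ->
  symbol a xi * (symbol a (xi + (2 * pi) *: w))^* =
  \sum_(u <- A) \sum_(t <- A) expi (dot (t - u) xi) * (torus_char w (t - u) *
    (torus_char w u * (real_complex R (a u) * real_complex R (a t)))).
Proof.
move=> A_uniq a_supp; rewrite !(symbolE A_uniq a_supp) rmorph_sum mulr_suml.
apply: eq_bigr => u _; rewrite mulr_sumr; apply: eq_bigr => t _.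
rewrite rmorphM /= conj_real_complex -expiN opprK.
rewrite [torus_char w _ * _]mulrA -torus_charD subrK dotDr dotZr expiD dotDl dotNl expiD.
by rewrite -/(torus_char w t); ring.
Qed.

Lemma dot_char_sep (R : realType) (d : nat) (p q : 'cV[int]_d) : p != q ->
  exists xi : 'cV[R]_d, expi (dot p xi) != expi (dot q xi).
Proof.
move=> pq; have [i pqi] : exists i, p i 0 != q i 0.
  apply: contrapT => /forallNP pqE; case/eqP: pq; apply/colP => i.
  by apply/eqP/negPn/negP/pqE.
have D0 : (p i 0)%:~R - (q i 0)%:~R != 0 :> R by rewrite subr_eq0 eqr_int.
(* Scaled so that the pairings with p and q differ by pi, where the exponential is -1. *)
exists ((pi / ((p i 0)%:~R - (q i 0)%:~R)) *: delta_mx i 0).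
rewrite !dotZr !dot_delta_r; set c := pi / _.
apply/eqP => eq_e; have : expi pi = 1 :> R[i].
  by rewrite -[pi](divfK D0) -/c mulrBr expiD eq_e -expiD subrr expi0.
by case => /eqP; rewrite cospi; lra.
Qed.

(** * Comparison of coefficients *)

Theorem theorem2p1 (R : realType) (d r : nat) (hd : (0 < d)%N) (hr : (0 < r)%N)
    (M : 'I_r -> 'M[int]_d) (hM : forall l, int_to_real_mx R (M l) \in unitmx)
    (a : 'I_r -> 'cV[int]_d -> R) (ha : forall l, finitely_supported (a l)) :
  (forall v : 'cV[int]_d -> R[i],
     \sum_(l < r) subdivision (a l) (M l) (transition (a l) (M l) v) = v)
  <->
  (forall w : 'cV[R]_d, (\bigcup_(l in [set: 'I_r]) Omega R (M l)) w ->
   forall xi : 'cV[R]_d,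
     \sum_(l < r | w \in Omega R (M l))
        symbol (a l) xi * (symbol (a l) (xi + (2 * pi) *: w))^* = delta w).
Proof.
have /choice[S SE] l : exists S : seq 'cV[int]_d, forall k, k \notin S -> a l k = 0.
  have /finite_seqP[S suppS] := ha l; exists S => k kNS.
  apply/eqP/negPn/negP => ak0; case/negP: kNS.
  by have : [set` S] k by rewrite -suppS.
pose A := undup (flatten [seq S l | l <- enum 'I_r]).
have A_uniq : uniq A := undup_uniq _.
have a_supp l k : k \notin A -> a l k = 0.
  move=> kNA; apply: SE; apply: contra kNA => kS; rewrite mem_undup.
  by apply/flattenP; exists (S l) => //; apply: map_f; rewrite mem_enum.
have /choice[Wl WlE] l := Omega_enum (hM l).
pose W := undup (flatten [seq Wl l | l <- enum 'I_r]).
have W_uniq : uniq W := undup_uniq _.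
have WE w : (w \in W) <-> (\bigcup_(l in [set: 'I_r]) Omega R (M l)) w.
  rewrite mem_undup; split=> [/flattenP[_ /mapP[l _ ->]]|[l _ wl]].
    by have [_ -> _] := WlE l; rewrite in_setE => wl; exists l.
  apply/flattenP; exists (Wl l); first by apply: map_f; rewrite mem_enum.
  by have [_ -> _] := WlE l; rewrite in_setE.
have W_cube w : w \in W -> forall i, 0 <= w i 0 < 1 by move=> /WE[l _ []].
(* Here r >= 1 enters: there is some Omega_M, and each contains 0. *)
have W0 : 0 \in W.
  apply/WE; exists (Ordinal hr) => //; split => [|i]; last by rewrite mxE lexx ltr01.
  by exists 0 => //; rewrite /int_to_real_mx map_mx0 mulmx0.
have sum_Wl l (f : 'cV[R]_d -> R[i]) :
    \sum_(w <- Wl l) f w = \sum_(w <- W | w \in Omega R (M l)) f w.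
  have [Wl_uniq Wl_mem _] := WlE l; rewrite -[RHS]big_filter.
  apply/perm_big/uniq_perm; rewrite ?filter_uniq // => w.
  rewrite mem_filter Wl_mem andb_idr // in_setE => wl; apply/WE.
  by exists l.
(* 0 is added by hand, as [A] may be empty. *)
pose P := undup (0 :: [seq t - u | u <- A, t <- A]).
have P_uniq : uniq P := undup_uniq _.
have P0 : 0 \in P by rewrite mem_undup mem_head.
have AP : {in A &, forall u t, t - u \in P}.
  move=> u t uA tA; rewrite mem_undup inE; apply/orP; right.
  by apply: (allpairs_f (fun u t => t - u)).
pose C w p : R[i] := \sum_(l < r | w \in Omega R (M l))
  \sum_(u <- A) \sum_(t <- A | t - u == p)
    torus_char w u * (real_complex R (a l u) * real_complex R (a l t)).
have iE v n : (\sum_(l < r) subdivision (a l) (M l) (transition (a l) (M l) v)) n =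
    \sum_(w <- W) torus_char w (- n) * \sum_(p <- P) C w p * v (n + p).
  rewrite fct_sumE.
  under eq_bigr => l _.
    have [_ _ Wl_sum] := WlE l.
    rewrite (subdivision_transitionE (hM l) A_uniq (@a_supp l) _ _ Wl_sum) sum_Wl.
    over.
  rewrite (exchange_big_dep xpredT) //=; apply: eq_bigr => w _.
  under eq_bigr do rewrite (sum_pairs_by_difference _ P_uniq AP).
  rewrite exchange_big mulr_sumr; apply: eq_bigr => p _.
  rewrite mulr_suml mulr_sumr; apply: eq_bigr => l _.
  rewrite mulr_suml mulr_sumr; apply: eq_bigr => u _.
  rewrite mulr_suml mulr_sumr; apply: eq_bigr => t /eqP tu.
  by rewrite torus_charD tu; ring.
have iiE w xi : \sum_(l < r | w \in Omega R (M l))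
      symbol (a l) xi * (symbol (a l) (xi + (2 * pi) *: w))^* =
    \sum_(p <- P) torus_char w p * C w p * expi (dot p xi).
  under eq_bigr => l _.
    rewrite (symbol_mul_conj _ _ A_uniq (@a_supp l)).
    rewrite (sum_pairs_by_difference _ P_uniq AP).
    over.
  rewrite exchange_big; apply: eq_bigr => p _.
  rewrite mulr_sumr mulr_suml; apply: eq_bigr => l _.
  rewrite mulr_sumr mulr_suml; apply: eq_bigr => u _.
  rewrite mulr_sumr mulr_suml; apply: eq_bigr => t /eqP tu.
  by rewrite tu; ring.
have sum_P p (f : 'cV[int]_d -> R[i]) : p \in P ->
    \sum_(q <- P) f q * (q == p)%:R = f p.
  move=> pP; rewrite (bigD1_seq p) //= eqxx mulr1 big1 ?addr0 // => q /negPf ->.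
  by rewrite mulr0.
have sum_W0 (f : 'cV[R]_d -> R[i]) : \sum_(w <- W) delta w * f w = f 0.
  rewrite (bigD1_seq 0) //= /delta eqxx mul1r big1 ?addr0 // => w /negPf ->.
  by rewrite mul0r.
have torus_char0w m : torus_char (0 : 'cV[R]_d) m = 1.
  by rewrite /torus_char dot0r mulr0 expi0.
pose CE := forall w p, w \in W -> p \in P -> C w p = delta w * (p == 0)%:R.
suff [iC iiC] : ((forall v : 'cV[int]_d -> R[i],
     \sum_(l < r) subdivision (a l) (M l) (transition (a l) (M l) v) = v) <-> CE) /\
  ((forall w : 'cV[R]_d, (\bigcup_(l in [set: 'I_r]) Omega R (M l)) w ->
   forall xi : 'cV[R]_d, \sum_(l < r | w \in Omega R (M l))
      symbol (a l) xi * (symbol (a l) (xi + (2 * pi) *: w))^* = delta w) <-> CE).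
  by rewrite iC iiC.
split; split=> [H w p wW pP|C_delta].
- have : C w p - delta w * (p == 0)%:R = 0; last by move/subr0_eq.
  apply: (@character_independence _ _ _ W (fun w n => torus_char w n)
    (fun w => C w p - delta w * (p == 0)%:R)) => //.
  + exact: torus_char0.
  + exact: torus_charD.
  + by move=> w1 w2 /W_cube w1I /W_cube w2I; apply: torus_char_sep.
  (* The constant [p = 0] is written as a multiple of the trivial character, that of w = 0. *)
  move=> x; transitivity (\sum_(w' <- W) torus_char w' x * C w' p -
      \sum_(w' <- W) delta w' * ((p == 0)%:R * torus_char w' x)).
    by rewrite -sumrB; apply: eq_bigr => w' _; ring.
  (* The unit mass at p - x, evaluated at -x, retains only C_w(p) in the inner sum. *)
  have := congr1 (fun g => g (- x)) (H (fun y => (y == - x + p)%:R)).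
  rewrite iE opprK sum_W0 torus_char0w mulr1.
  under eq_bigr => w' _.
    under eq_bigr do rewrite (inj_eq (addrI _)).
    rewrite sum_P //.
    over.
  by move=> ->; rewrite -[X in X == _]addr0 (inj_eq (addrI _)) eq_sym subrr.
- move=> v; apply/funext => n; rewrite iE.
  under eq_big_seq => w wW.
    under eq_big_seq => p pP do rewrite C_delta // mulrAC.
    rewrite sum_P // mulrCA addr0.
    over.
  by rewrite sum_W0 torus_char0w mul1r.
(* Now [w] is fixed and independence is applied in xi; the right-hand side is a multiple of the
   character of p = 0. *)
- have : torus_char w p * C w p - delta w * (p == 0)%:R = 0.
    apply: (@character_independence _ _ _ P (fun p xi => expi (dot p xi))
      (fun p => torus_char w p * C w p - delta w * (p == 0)%:R)) => //.
    + by move=> q; rewrite dot0r expi0.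
    + by move=> q x y; rewrite dotDr expiD.
    + by move=> p1 p2 _ _; apply: dot_char_sep.
    move=> xi; transitivity (\sum_(q <- P) torus_char w q * C w q * expi (dot q xi) -
        \sum_(q <- P) delta w * expi (dot q xi) * (q == 0)%:R).
      by rewrite -sumrB; apply: eq_bigr => q _; ring.
    rewrite -iiE H; last exact/WE.
    by rewrite sum_P // dot0l expi0 mulr1 subrr.
  (* The factor e_w(p) is removed: it is 1 at p = 0, and elsewhere it is nonzero while the
     right-hand side is 0. *)
  move/subr0_eq; have [-> |_] := eqVneq p 0; first by rewrite torus_char0 mul1r.
  by rewrite mulr0 => /eqP; rewrite mulf_eq0 (negPf (expi_neq0 _)) => /eqP.
- move=> w /WE wW xi; rewrite iiE.
  under eq_big_seq => p pP do rewrite C_delta // mulrA mulrAC.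
  by rewrite sum_P // dot0l expi0 torus_char0 mulr1 mul1r.
Qed.
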